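(* Let $A$ be an $N\times N$ real symmetric positive semi-definite matrix with eigenvalues $\beta_1\ge\dots\ge\beta_N$, let $u_N$ be an eigenvector of $A$ associated with $\beta_N$, $\|u_N\|=1$, and let $y\ne 0$ be a real $N\times 1$ vector. Set $y_N\equiv u_N^Ty$. Then $$\lambda_{\min}(A+yy^T)\ge\max\left\{\beta_N,\ y_N^2\,\frac{\mathrm{gap}}{\mathrm{gap}+\xi^2}\right\},$$ where $\mathrm{gap}\equiv\beta_{N-1}-\beta_N$ and $\xi\equiv|y_N|+\sqrt{\|y\|^2-|y_N|^2}$.
   Context: $\|\cdot\|$ is the Euclidean norm and $\lambda_{\min}(M)$ denotes the smallest eigenvalue of a real symmetric matrix $M$. Eigenvalues are counted with multiplicity; $N\ge 2$ so that $\beta_{N-1}$ makes sense. *)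

(* Defs.v *)
From mathcomp Require Import all_boot all_order all_algebra.
From mathcomp Require Import polyrcf.

Set Implicit Arguments.
Unset Strict Implicit.
Unset Printing Implicit Defensive.

Import Order.TTheory GRing.Theory Num.Theory.

Local Open Scope ring_scope.

Definition dotv (R : rcfType) (n : nat) (u v : 'cV[R]_n) : R :=
  (u^T *m v) 0 0.

(* [`|_|] on matrices is not used: the norm MathComp-Analysis puts on them is
   the sup norm. *)
Definition enorm (R : rcfType) (n : nat) (v : 'cV[R]_n) : R :=
  Num.sqrt (dotv v v).

Definition psd (R : rcfType) (n : nat) (A : 'M[R]_n) : Prop :=
  forall x : 'cV[R]_n, 0 <= dotv x (A *m x).

(* As [s] has as many entries as the degree of [char_poly A], it lists every
   eigenvalue with its multiplicity. *)
Definition ordered_spectrum (R : rcfType) (n : nat) (A : 'M[R]_n)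
    (s : n.-tuple R) : Prop :=
  sorted >=%R s /\ char_poly A = \prod_(b <- s) ('X - b%:P).

(* [rootsR] lists the roots in [R] in increasing order. The default 0 is
   returned only if [M] has no eigenvalue in [R], which does not happen for a
   symmetric [M] of positive size. *)
Definition lambda_min (R : rcfType) (n : nat) (M : 'M[R]_n) : R :=
  head 0 (rootsR (char_poly M)).

Lemma lambda_minP (R : rcfType) (n : nat) (M : 'M[R]_n) (a : R) :
  eigenvalue M a -> eigenvalue M (lambda_min M) /\ lambda_min M <= a.
Proof.
have nz : char_poly M != 0 by rewrite monic_neq0 // char_poly_monic.
have inE b : (b \in rootsR (char_poly M)) = eigenvalue M b.
  rewrite eigenvalue_root_char; have /(_ b) := roots_on_rootsR nz.
  by rewrite in_itv /= => <-.
rewrite -!inE /lambda_min; have : sorted <%R (rootsR (char_poly M)).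
  exact: sorted_roots.
case: (rootsR _) => [|x s] //= xs H; rewrite in_cons eqxx; split=> //.
move: xs; rewrite (path_sortedE lt_trans) => /andP[/allP xs _].
by case/predU1P: H => [->|/xs/ltW].
Qed.

(* Main.v *)
Require Import Defs.
From mathcomp Require Import all_boot all_order all_algebra.
From mathcomp Require Import complex zify ring lra.

Set Implicit Arguments.
Unset Strict Implicit.
Unset Printing Implicit Defensive.

Import Order.TTheory GRing.Theory Num.Theory.

Local Open Scope ring_scope.

(** The smallest eigenvalue of [A + y y^T] is the value
    [x^T A x + (y^T x)^2] of its quadratic form at a unit eigenvector [x].
    Split [x = a uN + w] with [w] orthogonal to [uN], and write [b] for the
    norm of [w]. Since the part of the spectrum of [A] carried by the orthogonal
    complement of [uN] starts at [beta_(N-1)] ([rayleigh_orthogonal_ge]),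
    [x^T A x >= beta_N a^2 + beta_(N-1) b^2 = beta_N + gap b^2].
    So the eigenvalue is at least [beta_N + gap b^2 + t^2] with [t = y^T x],
    which gives the bound [beta_N] at once.

    For the other bound, drop [beta_N >= 0]. Now [t] cannot be small unless [b]
    is large: with [z] the component of [y] orthogonal to [uN],
    [t = yN a + z^T w], and [1 <= |a| + b], so
    [|yN| <= |yN| |a| + |yN| b <= |t| + (|z| + |yN|) b = |t| + xi b].
    The Cauchy-Schwarz inequality for the weights [gap] and [1] then yields
    [yN^2 gap / (gap + xi^2) <= gap b^2 + t^2] ([weighted_square_sum_ge]).
    The proof is written homogeneously, without normalizing [x].

    The spectral theorem is applied over the complexification [R[i]]: a real
    symmetric matrix becomes Hermitian there, with real diagonal, so real
    quadratic forms are read off from the complex coordinates. This also shows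
    that a symmetric matrix does have an eigenvalue in [R], as is needed for
    [lambda_min] to be one. *)

(** * The Euclidean inner product *)

Section InnerProduct.
Variables (R : rcfType) (n : nat).
Implicit Types (u v w x : 'cV[R]_n) (a : R) (A : 'M[R]_n).

Lemma dotvE u v : dotv u v = \sum_i u i 0 * v i 0.
Proof. by rewrite /dotv mxE; apply: eq_bigr => i _; rewrite mxE. Qed.

Lemma dotvC u v : dotv u v = dotv v u.
Proof. by rewrite !dotvE; apply: eq_bigr => i _; rewrite mulrC. Qed.

Lemma dotvDr u v w : dotv u (v + w) = dotv u v + dotv u w.
Proof. by rewrite /dotv mulmxDr mxE. Qed.

Lemma dotvZr a u v : dotv u (a *: v) = a * dotv u v.
Proof. by rewrite /dotv -scalemxAr mxE. Qed.

Lemma dotvBr u v w : dotv u (v - w) = dotv u v - dotv u w.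
Proof. by rewrite -scaleN1r dotvDr dotvZr mulN1r. Qed.

Lemma dotvDl u v w : dotv (v + w) u = dotv v u + dotv w u.
Proof. by rewrite dotvC dotvDr !(dotvC u). Qed.

Lemma dotvZl a u v : dotv (a *: v) u = a * dotv v u.
Proof. by rewrite dotvC dotvZr (dotvC u). Qed.

Lemma dotvBl u v w : dotv (v - w) u = dotv v u - dotv w u.
Proof. by rewrite dotvC dotvBr !(dotvC u). Qed.

Lemma dotv_ge0 u : 0 <= dotv u u.
Proof. by rewrite dotvE sumr_ge0 // => i _; rewrite -expr2 sqr_ge0. Qed.

Lemma dotv_eq0 u : (dotv u u == 0) = (u == 0).
Proof.
apply/eqP/eqP => [|->]; last by rewrite /dotv mulmx0 mxE.
rewrite dotvE => u0; apply/colP => i; rewrite [RHS]mxE; apply/eqP.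
rewrite -sqrf_eq0 expr2; apply/eqP.
by apply: (psumr_eq0P _ u0) => // j _; rewrite -expr2 sqr_ge0.
Qed.

Lemma enorm_sqr u : enorm u ^+ 2 = dotv u u.
Proof. by rewrite /enorm sqr_sqrtr // dotv_ge0. Qed.

(** Expand the squared norm of [(v.v) u - (u.v) v], which is [v.v] times the
    difference of the two sides. *)
Lemma cauchy_schwarz_dotv u v : dotv u v ^+ 2 <= dotv u u * dotv v v.
Proof.
have [->|v_neq0] := eqVneq v 0.
  by rewrite /dotv !mulmx0 !mxE expr0n mulr0.
have v_gt0 : 0 < dotv v v by rewrite lt_def dotv_eq0 v_neq0 dotv_ge0.
have := dotv_ge0 (dotv v v *: u - dotv u v *: v).
rewrite !dotvBl !dotvBr !dotvZl !dotvZr (dotvC v u) => ge0.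
rewrite -subr_ge0 -(pmulr_rge0 _ v_gt0).
by apply: le_trans ge0 _; rewrite le_eqVlt; apply/orP; left; apply/eqP; ring.
Qed.

Lemma normr_dotv_le u v : `|dotv u v| <= enorm u * enorm v.
Proof.
rewrite -[leRHS]ger0_norm ?mulr_ge0 ?sqrtr_ge0 // -ler_sqr ?nnegrE //.
by rewrite !real_normK ?num_real // exprMn !enorm_sqr cauchy_schwarz_dotv.
Qed.

Lemma symmetricmxE A : A \is symmetricmx -> A^T = A.
Proof.
by move=> /is_hermitianmxP; rewrite expr0 scale1r map_mx_id // => <-.
Qed.

Lemma dotv_mulmx_sym A u v :
  A \is symmetricmx -> dotv u (A *m v) = dotv v (A *m u).
Proof.
move=> /symmetricmxE At; rewrite [RHS]dotvC /dotv mulmxA.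
by rewrite -[X in u^T *m X]At -trmx_mul.
Qed.

Lemma mulmx_rank_one u v : (u *m u^T) *m v = dotv u v *: u.
Proof.
rewrite -mulmxA; apply/colP => i; rewrite !mxE big_ord1 mulrC.
by congr (_ * _); rewrite /dotv mxE.
Qed.

Lemma symmetricmx_rank_one A u :
  A \is symmetricmx -> A + u *m u^T \is symmetricmx.
Proof.
move=> /symmetricmxE At; apply/is_hermitianmxP.
by rewrite expr0 scale1r map_mx_id // linearD /= At trmx_mul trmxK.
Qed.

End InnerProduct.

(** * Unitary diagonalization over the complexification *)

Section Spectral.
Variables (R : rcfType) (n : nat).
Local Notation C := (R[i]).
Local Notation toC := (map_mx (real_complex R)).
Local Open Scope sesquilinear_scope.

(** The intertwining form avoids [invmx]: [P] sends a vector to its coordinates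
    in an orthonormal eigenbasis, on which [A] acts by [d]. *)
Definition diagonalizes (A : 'M[R]_n) (P : 'M[C]_n) (d : 'rV[R]_n) :=
  P \is unitarymx /\ P *m toC A = diag_mx (toC d) *m P.

(** Over [R[i]] the matrix is Hermitian, hence normal, and its eigenvalues are
    self-conjugate; so the diagonal descends to [R] although [P] need not. *)
Lemma symmetric_diagonalizable (A : 'M[R]_n) : A \is symmetricmx ->
  exists P d, diagonalizes A P d.
Proof.
move=> /symmetricmxE At.
have Ah : toC A \is hermsymmx.
  apply: realsym_hermsym.
    by apply/is_hermitianmxP; rewrite expr0 scale1r map_mx_id // map_trmx At.
  by apply/mxOverP => i j; rewrite mxE complex_real.
have /orthomx_spectralP AE := hermitian_normalmx Ah.
have /mxOverP dr := hermitian_spectral_diag_real Ah.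
exists (spectralmx (toC A)), (map_mx (@complex.Re R) (spectral_diag (toC A))).
split; first exact: spectral_unitarymx.
have -> : toC (map_mx (@complex.Re R) (spectral_diag (toC A)))
  = spectral_diag (toC A).
  by apply/matrixP => i j; rewrite !mxE RRe_real.
by rewrite {2}AE -!mulmxA mulKVmx // spectral_unit.
Qed.

Variables (A : 'M[R]_n) (P : 'M[C]_n) (d : 'rV[R]_n).
Hypothesis AP : diagonalizes A P d.

(** Cancel [\det P] in [\det P * \det (X - A) = \det (X - d) * \det P]. *)
Lemma char_poly_diagonalizes : char_poly A = \prod_i ('X - (d 0 i)%:P).
Proof.
have [Pu PA] := AP.
have detP : \det (map_mx polyC P) != 0.
  by rewrite det_map_mx polyC_eq0 -unitfE -unitmxE unitarymx_unit.
have diagE : \prod_i ('X - (d 0 i)%:P) = char_poly (diag_mx d).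
  rewrite char_poly_trig ?diag_mx_is_trig //.
  by apply: eq_bigr => i _; rewrite !mxE eqxx.
rewrite diagE; apply: (@map_poly_inj _ _ (real_complex R)).
rewrite !map_char_poly map_diag_mx; apply: (mulfI detP).
rewrite /char_poly -det_mulmx [RHS]mulrC -det_mulmx; congr (\det _).
rewrite /char_poly_mx mulmxBr mulmxBl -!map_mxM PA.
by rewrite mul_mx_scalar mul_scalar_mx.
Qed.

Definition coords (w : 'cV[R]_n) : 'cV[C]_n := P *m toC w.

Lemma dotv_coords (u w : 'cV[R]_n) :
  (dotv u w)%:C%C = \sum_i (coords u i 0)^* * coords w i 0.
Proof.
have [/unitarymxP/mulmx1C Pu _] := AP.
transitivity (((coords u)^t* *m coords w) 0 0); last first.
  by rewrite mxE; apply: eq_bigr => i _; rewrite !mxE.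
rewrite /coords trmx_mul map_mxM -mulmxA (mulmxA (P^t*)) Pu mul1mx.
rewrite dotvE mxE rmorph_sum /=; apply: eq_bigr => i _.
rewrite !mxE rmorphM /=; congr (_ * _); apply/esym.
exact: conjc_real.
Qed.

Lemma coords_mulmx (w : 'cV[R]_n) i :
  coords (A *m w) i 0 = (d 0 i)%:C%C * coords w i 0.
Proof.
have [_ PA] := AP.
by rewrite /coords map_mxM mulmxA PA -mulmxA mul_diag_mx !mxE.
Qed.

Lemma coords_eigenvector (u : 'cV[R]_n) b i :
  A *m u = b *: u -> coords u i 0 != 0 -> d 0 i = b.
Proof.
move=> Au u_neq0; apply: (@complexI R); apply: (mulIf u_neq0).
by rewrite -coords_mulmx Au /coords map_mxZ -scalemxAr mxE.
Qed.

(** Only the eigenvalues along which [w] has a component matter: this is what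
    allows a bound better than the smallest eigenvalue. *)
Lemma quadratic_form_ge (m : R) (w : 'cV[R]_n) :
  (forall i, coords w i 0 != 0 -> m <= d 0 i) ->
  m * dotv w w <= dotv w (A *m w).
Proof.
move=> dm; rewrite -lecR rmorphM /= !dotv_coords mulr_sumr ler_sum // => i _.
rewrite coords_mulmx [leRHS]mulrCA.
have [->|w_neq0] := eqVneq (coords w i 0) 0; first by rewrite !mulr0.
by rewrite ler_wpM2r ?lecR ?dm // mulrC mul_conjC_ge0.
Qed.

End Spectral.

(** * Eigenvalues of real symmetric matrices *)

Lemma symmetric_has_eigenvalue (R : rcfType) (n : nat) (A : 'M[R]_n) :
  (0 < n)%N -> A \is symmetricmx -> exists a, eigenvalue A a.
Proof.
move=> n_gt0 /symmetric_diagonalizable[P [d /char_poly_diagonalizes Ad]].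
exists (d 0 (Ordinal n_gt0)); rewrite eigenvalue_root_char Ad.
by rewrite (bigD1 (Ordinal n_gt0)) //= rootM root_XsubC eqxx.
Qed.

Lemma lambda_min_eigenvector (R : rcfType) (n : nat) (M : 'M[R]_n) :
    (0 < n)%N -> M \is symmetricmx ->
  exists2 x : 'cV[R]_n, x != 0 & M *m x = lambda_min M *: x.
Proof.
move=> n_gt0 Msym; have [a /lambda_minP[/eigenvalueP[v vM v_neq0] _]] :=
  symmetric_has_eigenvalue n_gt0 Msym.
(* Eigenvectors in the sense of [eigenvalue] are rows. *)
exists v^T; first by rewrite trmx_eq0.
by rewrite -{1}(symmetricmxE Msym) -trmx_mul vM linearZ.
Qed.

Lemma nth_sorted_ge (R : rcfType) (s : seq R) i j :
  sorted >=%R s -> (i <= j)%N -> (j < size s)%N -> s`_j <= s`_i.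
Proof.
move=> s_sorted ij j_lt.
have ge_trans : transitive (>=%R : rel R).
  by move=> a b c /= ba ac; apply: le_trans ac ba.
have ge_refl : reflexive (>=%R : rel R) by move=> a /=.
apply: (sorted_leq_nth ge_trans ge_refl 0 s_sorted) => //.
by rewrite inE (leq_ltn_trans ij).
Qed.

(** Only the last entry can be smaller than the penultimate one. Counting,
    rather than naming the last entry, survives the permutation that relates
    [s] to the diagonal of a diagonalization. *)
Lemma count_lt_penultimate (R : rcfType) (s : seq R) :
    (2 <= size s)%N -> sorted >=%R s ->
  (count (fun a => a < s`_(size s).-2)%R s <= 1)%N.
Proof.
move=> s_ge2 s_sorted; set m := s`_ _.
have s_gt : ((size s).-1 < size s)%N by case: (size s) s_ge2.
rewrite -(cat_take_drop (size s).-1 s) count_cat.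
have take_ge a : a \in take (size s).-1 s -> (a < m) = false.
  case/(nthP (0 : R)) => i; rewrite size_takel ?leq_pred // => i_lt <-.
  rewrite nth_take //; apply/negbTE; rewrite -leNgt.
  by apply: nth_sorted_ge => //; lia.
rewrite (eq_in_count take_ge) count_pred0 add0n.
apply: leq_trans (count_size _ _) _; rewrite size_drop.
by case: (size s) s_gt => //= k _; rewrite subSnn.
Qed.

Section OrderedSpectrum.
Variables (R : rcfType) (n : nat) (A : 'M[R]_n) (s : n.-tuple R).
Hypotheses (n_ge2 : (2 <= n)%N) (A_sym : A \is symmetricmx).
Hypothesis As : ordered_spectrum A s.

Lemma perm_spectrum P d : diagonalizes A P d ->
  perm_eq s [seq d 0 i | i <- enum 'I_n].
Proof.
move=> /char_poly_diagonalizes Ad; have [_ As'] := As.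
apply: prod_XsubC_eq; rewrite -As' Ad big_map enumT.
by [].
Qed.

Lemma spectrum_ge_last P d i : diagonalizes A P d -> s`_n.-1 <= d 0 i.
Proof.
move=> /perm_spectrum ds; have [s_sorted _] := As.
have : d 0 i \in (s : seq R) by rewrite (perm_mem ds) map_f ?mem_enum.
case/(nthP (0 : R)) => k; rewrite size_tuple => k_lt <-.
by apply: nth_sorted_ge => //; rewrite ?size_tuple; lia.
Qed.

Lemma diagonal_lt_penultimate_inj P d i j : diagonalizes A P d ->
  d 0 i < s`_n.-2 -> d 0 j < s`_n.-2 -> i = j.
Proof.
move=> /perm_spectrum ds di dj; have [s_sorted _] := As.
have : (#|[pred k | (d 0 k < s`_n.-2)%R]| <= 1)%N.
  have := count_lt_penultimate _ s_sorted; rewrite size_tuple => /(_ n_ge2).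
  by rewrite (permP ds) count_map -sum1_card -sum1_count big_enum_cond.
by move/card_le1_eqP; apply; rewrite inE.
Qed.

(** If a diagonal entry [d_i] is below the penultimate eigenvalue, it is the
    only one, so the eigenvector [u] of the last eigenvalue has no other
    coordinate than the [i]-th; orthogonality to [u] then kills the [i]-th
    coordinate of [w]. If the last two eigenvalues coincide there is no such
    [i], whatever the choice of [u] in the eigenspace. *)
Lemma rayleigh_orthogonal_ge (u w : 'cV[R]_n) :
    A *m u = s`_n.-1 *: u -> u != 0 -> dotv u w = 0 ->
  s`_n.-2 * dotv w w <= dotv w (A *m w).
Proof.
move=> Au u_neq0 uw0; have [P [d AP]] := symmetric_diagonalizable A_sym.
apply: (quadratic_form_ge AP) => i; rewrite leNgt; apply: contra => di.
have d_ge_last : s`_n.-1 <= d 0 i by exact: spectrum_ge_last AP.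
have only_i j : j != i -> coords P u j 0 = 0.
  move=> ji; apply/eqP; apply: contraNT ji => /(coords_eigenvector AP Au) dj.
  apply/eqP/(diagonal_lt_penultimate_inj AP) => //.
  by rewrite dj (le_lt_trans d_ge_last).
have dotv_u v : (dotv u v)%:C%C = (coords P u i 0)^* * coords P v i 0.
  rewrite (dotv_coords AP) (bigD1 i) //= big1 ?addr0 // => j /only_i ->.
  by rewrite conjC0 mul0r.
have ui_neq0 : coords P u i 0 != 0.
  apply: contraNneq u_neq0 => ui0; rewrite -dotv_eq0; apply/eqP.
  by apply: (@complexI R); rewrite dotv_u ui0 mulr0.
have /esym/eqP := dotv_u w; rewrite uw0 mulf_eq0 conjC_eq0 (negbTE ui_neq0).
by [].
Qed.

End OrderedSpectrum.

(** * The lower bound *)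

Lemma orthogonal_component (R : rcfType) (n : nat) (u x : 'cV[R]_n) :
  dotv u u = 1 -> dotv u (x - dotv u x *: u) = 0.
Proof. by move=> u1; rewrite dotvBr dotvZr u1 mulr1 subrr. Qed.

Lemma dotv_decomposition (R : rcfType) (n : nat) (u x y : 'cV[R]_n) :
  dotv u u = 1 ->
  dotv y x = dotv u y * dotv u x
    + dotv (y - dotv u y *: u) (x - dotv u x *: u).
Proof.
move=> u1; rewrite !dotvBl !dotvBr !dotvZl !dotvZr u1 (dotvC y u).
by ring.
Qed.

(** Cauchy-Schwarz for [t + xi b = 1 t + (xi / sqrt g) (sqrt g b)], with the
    denominators cleared so that [g = 0] needs no separate treatment; the defect
    is [(g b - xi t)^2]. If also [xi = 0], the quotient is [0 / 0 = 0]. *)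
Lemma weighted_square_sum_ge (R : realFieldType) (g xi b t c : R) :
    0 <= g -> 0 <= c -> c <= t + xi * b ->
  c ^+ 2 * (g / (g + xi ^+ 2)) <= g * b ^+ 2 + t ^+ 2.
Proof.
move=> g_ge0 c_ge0 c_le.
have [den0|den_neq0] := eqVneq (g + xi ^+ 2) 0.
  by rewrite den0 invr0 !mulr0 addr_ge0 ?sqr_ge0 // mulr_ge0 ?sqr_ge0.
have den_gt0 : 0 < g + xi ^+ 2 by rewrite lt_def den_neq0 addr_ge0 ?sqr_ge0.
rewrite mulrA ler_pdivrMr //.
apply: (@le_trans _ _ ((t + xi * b) ^+ 2 * g)).
  by rewrite ler_wpM2r // ler_sqr ?nnegrE // (le_trans c_ge0).
rewrite -subr_ge0.
have -> : (g * b ^+ 2 + t ^+ 2) * (g + xi ^+ 2) - (t + xi * b) ^+ 2 * g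
  = (g * b - xi * t) ^+ 2 by ring.
exact: sqr_ge0.
Qed.

Theorem theorem3p3 (R : rcfType) (N : nat) (hN : (2 <= N)%N)
    (A : 'M[R]_N) (A_sym : A \is symmetricmx) (A_psd : psd A)
    (beta : N.-tuple R) (beta_spec : ordered_spectrum A beta)
    (uN : 'cV[R]_N) (uN_eig : A *m uN = beta`_(N.-1) *: uN)
    (uN_norm : enorm uN = 1)
    (y : 'cV[R]_N) (y_neq0 : y != 0) :
  let yN := dotv uN y in
  let gap := beta`_(N.-2) - beta`_(N.-1) in
  let xi := `|yN| + Num.sqrt (enorm y ^+ 2 - `|yN| ^+ 2) in
  lambda_min (A + y *m y^T)
    >= Num.max beta`_(N.-1) (yN ^+ 2 * (gap / (gap + xi ^+ 2))).
Proof.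
cbv zeta; set yN := dotv uN y; set gap := beta`_N.-2 - _.
set xi := `|yN| + _.
have u1 : dotv uN uN = 1 by rewrite -enorm_sqr uN_norm expr1n.
have u_neq0 : uN != 0 by rewrite -dotv_eq0 u1 oner_eq0.
have gap_ge0 : 0 <= gap.
  have [beta_sorted _] := beta_spec.
  by rewrite subr_ge0 nth_sorted_ge ?size_tuple //; lia.
have betaN_ge0 : 0 <= beta`_N.-1.
  by have := A_psd uN; rewrite uN_eig dotvZr u1 mulr1.
have [|x x_neq0 Mx] := lambda_min_eigenvector _ (symmetricmx_rank_one y A_sym).
  exact: ltnW.
have x_gt0 : 0 < dotv x x by rewrite lt_def dotv_eq0 x_neq0 dotv_ge0.
set lam := lambda_min _ in Mx *.
pose a := dotv uN x; pose w := x - a *: uN; pose z := y - yN *: uN.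
pose b := enorm w; pose t := dotv y x.
have uw0 : dotv uN w = 0 := orthogonal_component x u1.
have xx : dotv x x = a ^+ 2 + b ^+ 2.
  by rewrite (dotv_decomposition x x u1) -expr2 /b enorm_sqr.
have yx : t = yN * a + dotv z w := dotv_decomposition x y u1.
have quad : lam * dotv x x = dotv x (A *m x) + t ^+ 2.
  by rewrite -dotvZr -Mx mulmxDl mulmx_rank_one dotvDr dotvZr (dotvC x y).
have quadA : dotv x (A *m x) = beta`_N.-1 * a ^+ 2 + dotv w (A *m w).
  have xE : x = a *: uN + w by rewrite addrC subrK.
  (* [dotvDl] would otherwise expand the difference that defines [w]. *)
  clearbody w.
  rewrite {1 2}xE mulmxDr -scalemxAr uN_eig.
  rewrite !dotvDl !dotvDr !dotvZl !dotvZr u1 (dotvC w uN) uw0.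
  by rewrite (dotv_mulmx_sym _ _ A_sym) uN_eig dotvZr (dotvC w uN) uw0; ring.
have quadw : beta`_N.-2 * b ^+ 2 <= dotv w (A *m w).
  by rewrite /b enorm_sqr; apply: rayleigh_orthogonal_ge uN_eig _ uw0.
have lower : beta`_N.-1 * dotv x x + (gap * b ^+ 2 + t ^+ 2) <= lam * dotv x x.
  by rewrite quad quadA xx /gap; lra.
have rest_ge0 : 0 <= gap * b ^+ 2 + t ^+ 2.
  by rewrite addr_ge0 ?sqr_ge0 // mulr_ge0 ?sqr_ge0.
rewrite ge_max; apply/andP; split; rewrite -(ler_pM2r x_gt0); first by lra.
have xiE : xi = `|yN| + enorm z.
  rewrite /xi /enorm real_normK ?num_real // -/(enorm y) enorm_sqr.
  by rewrite (dotv_decomposition y y u1) -/z -/yN; congr (_ + Num.sqrt _); ring.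
have b_ge0 : 0 <= b := sqrtr_ge0 _.
have x_le : enorm x <= `|a| + b.
  rewrite -ler_sqr ?nnegrE ?sqrtr_ge0 ?addr_ge0 // enorm_sqr xx.
  rewrite -(real_normK (num_real a)) sqrrD [leRHS]addrAC lerDl.
  by rewrite mulrn_wge0 ?mulr_ge0.
have key : `|yN| * enorm x <= `|t| + xi * b.
  have yNa : `|yN| * `|a| <= `|t| + enorm z * b.
    rewrite -normrM (_ : yN * a = t - dotv z w); last by rewrite yx addrK.
    by apply: le_trans (ler_normB _ _) _; rewrite lerD2l normr_dotv_le.
  have := ler_wpM2l (normr_ge0 yN) x_le; rewrite xiE; lra.
have := weighted_square_sum_ge gap_ge0 _ key.
rewrite mulr_ge0 ?sqrtr_ge0 // => /(_ isT).
rewrite exprMn !real_normK ?num_real // enorm_sqr mulrAC => bound.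
apply: le_trans bound (le_trans _ lower).
by rewrite lerDr mulr_ge0 // ltW.
Qed.
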